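(* For all $n\ge 4$, $\rho(AQ_n)=3$.
   Context: The augmented hypercube $AQ_n$ has vertex set $\mathbb{Z}_2^n$; two vertices are adjacent iff either they differ in exactly one position, or for some $0\le \ell\le n-2$ they agree in the first $\ell$ positions and differ in all of the remaining $n-\ell$ positions. For $n\ge4$, $AQ_n$ has a distinguishing coloring with 2 colors (a coloring for which the only automorphism preserving each color class is the identity). For such a graph $G$, the cost $\rho(G)$ is the minimum size of a color class over all distinguishing 2-colorings of $G$. *)

(* Defs.v *)
From mathcomp Require Import all_boot all_order all_algebra all_fingroup.

Set Implicit Arguments.
Unset Strict Implicit.
Unset Printing Implicit Defensive.

(* A graph is given by its adjacency relation on a finite vertex type. *)
Definition is_automorphism (V : finType) (e : rel V) (f : {perm V}) : bool :=
  [forall x, forall y, e (f x) (f y) == e x y].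

Definition color_class (V : finType) (k : nat) (c : {ffun V -> 'I_k})
    (i : 'I_k) : {set V} :=
  [set x | c x == i].

Definition distinguishing (V : finType) (e : rel V) (k : nat)
    (c : {ffun V -> 'I_k}) : bool :=
  [forall f : {perm V},
     (is_automorphism e f &&
      [forall i, f @: color_class c i == color_class c i])
     ==> (f == 1%g)].

(* Every color class has at most #|V| elements, so the default value #|V| of
   the iterated minimum only matters when e has no distinguishing 2-coloring,
   in which case the cost is undefined on paper. *)
Definition cost (V : finType) (e : rel V) : nat :=
  \big[minn/#|V|]_(c : {ffun V -> 'I_2} | distinguishing e c)
    \big[minn/#|V|]_(i : 'I_2) #|color_class c i|.

Lemma bigminn_le (I : finType) (P : pred I) (F : I -> nat) (x : nat) (j : I) :
  P j -> \big[minn/x]_(i | P i) F i <= F j.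
Proof.
move=> Pj; have := mem_index_enum j.
elim: (index_enum I) => // i s IHs; rewrite inE big_cons.
case/predU1P=> [<-|/IHs le_s]; first by rewrite Pj geq_minl.
by case: ifP => // _; apply: leq_trans (geq_minr _ _) le_s.
Qed.

Lemma cost_le (V : finType) (e : rel V) (c : {ffun V -> 'I_2}) (i : 'I_2) :
  distinguishing e c -> cost e <= #|color_class c i|.
Proof.
by move=> dc; apply: leq_trans (bigminn_le _ _ dc) (bigminn_le _ _ _).
Qed.

Lemma cost_attained (V : finType) (e : rel V) :
    (exists c : {ffun V -> 'I_2}, distinguishing e c) ->
  exists (c : {ffun V -> 'I_2}) (i : 'I_2),
    distinguishing e c /\ #|color_class c i| = cost e.
Proof.
move=> [c0 dc0].
pose K m := m = #|V| \/ exists (c : {ffun V -> 'I_2}) (i : 'I_2),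
  distinguishing e c /\ #|color_class c i| = m.
have Kmin m1 m2 : K m1 -> K m2 -> K (minn m1 m2) by rewrite /minn; case: ifP.
have: K (cost e).
  apply: (big_ind K) => //; first by left.
  move=> c dc; apply: (big_ind K) => //; first by left.
  by move=> i _; right; exists c, i.
case=> // costV; exists c0, ord0; split=> //; apply/eqP.
by rewrite eqn_leq cost_le // costV max_card.
Qed.

(* Position i of the paper is index i - 1 here: agreeing in the first l
   positions means agreeing at every index i < l. The values l = 0 .. n - 2 are
   the elements of 'I_n.-1. *)
Definition AQ (n : nat) : rel 'rV['F_2]_n := fun x y =>
  (#|[set i : 'I_n | x ord0 i != y ord0 i]| == 1) ||
  [exists l : 'I_n.-1, [forall i : 'I_n,
     if i < l then x ord0 i == y ord0 i else x ord0 i != y ord0 i]].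

(* Main.v *)
Require Import Defs.
From mathcomp Require Import all_boot all_order all_algebra all_fingroup.
From mathcomp Require Import zify.

(* Identify Z_2^n with the even subsets of {0, ..., n} so that AQ_n becomes the
   Cayley graph whose generators are the pairs {i, j} with 1 <= |i - j| <= 2,
   i.e. the edges of the square of a path. Adjacency questions are then about
   which pairs of path-square edges have a given symmetric difference.

   An automorphism fixing a vertex and all its neighbors is the identity: two
   generators u, v usually have 0 and u + v as only common neighbors outside the
   neighborhood of 0; the exceptions {i, i+3} and {i, i+1, i+2, i+3} are told
   apart by {i, i+4} or {i-1, i+3}, one of which exists as n >= 4. Hence the ball
   of radius 2 is fixed, and translation propagates this to the whole graph.

   The class {0, {0,1}, {0,2,n-1,n}} is distinguishing: a color-preserving
   automorphism fixes the three vertices, then the neighbors of 0 one after the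
   other along the path, the last vertex detecting a swap at the far end. A class
   of size 0 or 2 is preserved by a translation, and a class of size 1 by a
   translate of the linear map swapping {0,1} and {0,2}. *)

Set Implicit Arguments.
Unset Strict Implicit.
Unset Printing Implicit Defensive.

Import GRing.Theory.
Local Open Scope ring_scope.

(** * Vectors over F_2 encoded by lists of path vertices *)

Lemma F2_add_self (x : 'F_2) : x + x = 0.
Proof. by rewrite -mulr2n -mulr_natr pchar_Zp // mulr0. Qed.

Lemma row2_addK n (x y : 'rV['F_2]_n) : x + (x + y) = y.
Proof. by rewrite addrA; apply/rowP=> k; rewrite !mxE F2_add_self add0r. Qed.

Lemma row2_opp n (x : 'rV['F_2]_n) : - x = x.
Proof.
apply/eqP; rewrite eq_sym -addr_eq0; apply/eqP/rowP=> k.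
by rewrite !mxE F2_add_self.
Qed.

Lemma row2_add_self n (x : 'rV['F_2]_n) : x + x = 0.
Proof. by rewrite -{2}[x]row2_opp subrr. Qed.

Lemma row2_add_eq0 n (x y : 'rV['F_2]_n) : (x + y == 0) = (x == y).
Proof. by rewrite addr_eq0 row2_opp. Qed.

Lemma natF2_eq0 m : (m%:R == 0 :> 'F_2) = ~~ odd m.
Proof. by rewrite -(dvdn_pcharf (pchar_Fp _)) // dvdn2. Qed.

Lemma natF2_eq m p : ~~ odd (m + p) -> m%:R = p%:R :> 'F_2.
Proof.
move=> mp; apply/eqP; rewrite -subr_eq0 (addr0_eq (F2_add_self _)) -natrD.
by rewrite natF2_eq0.
Qed.

(* The coordinates in which vertex j of the path, relative to vertex 0, is seen:
   [bd j + bd j.+1] is the vector of ones from index j on, and [bd j + bd j.+2]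
   is the unit vector at j. *)
Definition bd n (j : nat) : 'rV['F_2]_n := \row_k (minn j k.+1)%:R.

Definition bdsum n (l : seq nat) : 'rV['F_2]_n := \sum_(j <- l) bd n j.

Definition evens (l : seq nat) := forall m, ~~ odd (count_mem m l).

(* Edges of the square of the path 0, ..., n. *)
Definition edge n i j := [&& i < j, j <= n & j <= i.+2]%N.

Lemma bdsumE n l k : bdsum n l ord0 k = (sumn [seq minn j k.+1 | j <- l])%:R.
Proof.
rewrite /bdsum; elim: l => [|a l IH] /=; first by rewrite big_nil mxE.
by rewrite big_cons natrD -IH !mxE.
Qed.

(** The second difference of [minn j] at m is minus the indicator of j = m + 1, so the coordinates
    modulo 2 determine the parity of every positive multiplicity. *)
Lemma count_mem_minn (l : seq nat) m :
  (count_mem m.+1 l + sumn [seq minn j m | j <- l]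
   + sumn [seq minn j m.+2 | j <- l]
   = 2 * sumn [seq minn j m.+1 | j <- l])%N.
Proof. by elim: l => [|a l] //=; move: (count _ _) => c; lia. Qed.

Lemma count_mem0_minn (l : seq nat) :
  (count_mem 0 l + sumn [seq minn j 1 | j <- l] = size l)%N.
Proof. by elim: l => [|a l] //=; move: (count _ _) => c; lia. Qed.

(** The hypotheses make up for what coordinates cannot see: [bd n 0] is zero, so the parity of the
    multiplicity of 0 comes from that of the length, and [bd n j] is the same for all j from n
    on. *)
Lemma bdsum_eq0_evens n l : all (leq^~ n) l -> ~~ odd (size l) ->
  bdsum n l = 0 -> evens l.
Proof.
move=> ln odl /rowP s0.
have M m : ~~ odd (sumn [seq minn j m | j <- l]).
  wlog mn : m / (m <= n)%N.
    move=> W; case: (leqP m n) => [/W//|nm].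
    suff -> : sumn [seq minn j m | j <- l] = sumn [seq minn j n | j <- l].
      exact: W.
    congr sumn; apply/eq_in_map => j /(allP ln) /= jn; lia.
  case: m mn => [_|m mn]; first by elim: (l) => //= a s; rewrite minn0.
  by have := s0 (Ordinal mn); rewrite bdsumE mxE /= => /eqP; rewrite natF2_eq0.
case=> [|m].
  have := count_mem0_minn l; have := M 1%N; lia.
have := count_mem_minn l m; have := M m; have := M m.+2; lia.
Qed.

Lemma evens_rem a l : evens (a :: l) -> a \in l /\ evens (rem a l).
Proof.
move=> e; have al : a \in l.
  rewrite -has_pred1 has_count; have := e a; rewrite /= eqxx; lia.
split=> // m; have := e m.
by have /seq.permP/(_ (pred1 m)) := perm_to_rem al => /= ->; lia.
Qed.

(* The entries of l can be paired off into equal ones (only [fuel] pairs are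
   formed), spelled out as a disjunction that reduces on explicit lists. *)
Fixpoint matched (fuel : nat) (l : seq nat) : Prop :=
  if fuel is k.+1 then
    if l is a :: l' then
      (fix pick pre s := if s is b :: s' then
         (a = b /\ matched k (catrev pre s')) \/ pick (b :: pre) s'
         else False) [::] l'
    else True
  else True.

Lemma evens_matched fuel l : evens l -> matched fuel l.
Proof.
elim: fuel l => [//|k IH] [//|a l] e /=.
have [al _] := evens_rem e.
(* Generalize over the entries already skipped, kept reversed as in the accumulator of [pick]. *)
have {e} : evens (a :: catrev [::] l) by [].
elim: l [::] al => [//|b l IHl] pre; rewrite inE => al e.
case: (eqVneq a b) al => [ab _|nab /= al].
  left; split=> //; apply: IH => m; have := e m.
  by rewrite /= !catrevE !count_cat /= ab; lia.
by right; apply: IHl.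
Qed.

Lemma evens_bdsum_eq0 n l : evens l -> bdsum n l = 0.
Proof.
elim: {l}(size l) {-2}l (leqnn (size l)) => [|k IH] [|a l] //= sz e.
- by rewrite /bdsum big_nil.
- by rewrite /bdsum big_nil.
have [al e'] := evens_rem e.
rewrite /bdsum big_cons (perm_big _ (perm_to_rem al)) big_cons /= row2_addK.
by apply: IH => //; rewrite size_rem // -ltnS (leq_trans _ sz) // ltnS leq_pred.
Qed.

Lemma bdsum_cat n l1 l2 : bdsum n (l1 ++ l2) = bdsum n l1 + bdsum n l2.
Proof. exact: big_cat. Qed.

Lemma bdsum2 n i j : bdsum n [:: i; j] = bd n i + bd n j.
Proof. by rewrite /bdsum !big_cons big_nil addr0. Qed.

Lemma evens_bdsum_eq n l1 l2 : evens (l1 ++ l2) -> bdsum n l1 = bdsum n l2.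
Proof.
by move=> /(evens_bdsum_eq0 n)/eqP; rewrite bdsum_cat row2_add_eq0 => /eqP.
Qed.

Lemma bdsum_eq_evens n l1 l2 : all (leq^~ n) (l1 ++ l2) ->
  ~~ odd (size (l1 ++ l2)) -> bdsum n l1 = bdsum n l2 -> evens (l1 ++ l2).
Proof.
move=> le od /eqP; rewrite -row2_add_eq0 -bdsum_cat => /eqP.
exact: bdsum_eq0_evens.
Qed.

(** * Adjacency in terms of path-square edges *)

Lemma neq_coord n (x y : 'rV['F_2]_n) k :
  (x ord0 k != y ord0 k) = ((x + y) ord0 k == 1).
Proof.
rewrite mxE; move: (x ord0 k) (y ord0 k) => [[|[|//]] p] [[|[|//]] q]; by [].
Qed.

Lemma bdsum_suffix n i (k : 'I_n) :
  bdsum n [:: i; i.+1] ord0 k = (i <= k)%N%:R.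
Proof. by rewrite bdsum2 !mxE -natrD; apply: natF2_eq; lia. Qed.

Lemma bdsum_delta n i (k : 'I_n) : (i.+2 <= n)%N ->
  bdsum n [:: i; i.+2] ord0 k = (k == i :> nat)%:R.
Proof. by move=> lin; rewrite bdsum2 !mxE -natrD; apply: natF2_eq; lia. Qed.

Lemma AQ_P n (x y : 'rV['F_2]_n) : (1 < n)%N ->
  reflect (exists i j, edge n i j /\ x + y = bdsum n [:: i; j]) (AQ x y).
Proof.
move=> n1.
have b1 (b : bool) : (b%:R == 1 :> 'F_2) = b by case: b.
have F2E (a : 'F_2) : a = (a == 1)%:R by case: a => [[|[|//]] p]; apply/val_inj.
have -> : AQ x y =
  (#|[set k : 'I_n | (x + y) ord0 k == 1]| == 1%N) ||
  [exists l : 'I_n.-1, [forall k : 'I_n, ((x + y) ord0 k == 1) == (l <= k)%N]].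
  congr orb.
    by congr (_ == _); apply: eq_card => k; rewrite !inE neq_coord.
  apply: eq_existsb => l; apply: eq_forallb => k; rewrite -neq_coord.
  by case: ltnP => _; case: eqP.
apply: (iffP orP).
  case=> [/cards1P[k /setP E]|/existsP[l /forallP E]].
    have Ek m : (x + y) ord0 m = (m == k)%:R.
      by rewrite [LHS]F2E; have := E m; rewrite !inE => ->.
    case: (leqP k.+2 n) => kn.
      exists k, k.+2; split; first by rewrite /edge; lia.
      by apply/rowP=> m; rewrite bdsum_delta // Ek.
    (* Now k = n - 1: the unit vector at the last index is also the vector of ones from there on, so
       the edge is {n-1, n}. *)
    exists k, k.+1; split; first by rewrite /edge; have := ltn_ord k; lia.
    apply/rowP=> m; rewrite bdsum_suffix // Ek; congr (nat_of_bool _)%:R.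
    by have := ltn_ord m; have := ltn_ord k; rewrite -val_eqE /=; lia.
  exists l, l.+1; split; first by rewrite /edge; have := ltn_ord l; lia.
  apply/rowP=> m; rewrite bdsum_suffix // [LHS]F2E; congr (nat_of_bool _)%:R.
  exact: (eqP (E m)).
move=> [i [j [/and3P[ij jn ji] ->]]].
have [ji2|ji1] : j = i.+2 \/ j = i.+1 by lia.
  rewrite ji2 in jn *; have lin : (i < n)%N by lia.
  left; apply/cards1P; exists (Ordinal lin); apply/setP => k.
  by rewrite !inE bdsum_delta ?b1 //.
move: jn; rewrite ji1 => jn.
case: (ltnP i n.-1) => lin.
  right; apply/existsP; exists (Ordinal lin); apply/forallP => k.
  by rewrite bdsum_suffix b1.
(* The edge {n-1, n} falls outside the range l <= n - 2 and is a difference in the last position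
   only. *)
left; apply/cards1P; exists (Ordinal jn); apply/setP => k.
rewrite !inE bdsum_suffix b1 -val_eqE /=; have := ltn_ord k; lia.
Qed.

Lemma AQ_bdsum n l1 l2 i j : (1 < n)%N -> edge n i j ->
  evens [:: i, j & l1 ++ l2] -> AQ (bdsum n l1) (bdsum n l2).
Proof.
move=> n1 ij e; apply/AQ_P => //; exists i, j; split=> //.
by rewrite -bdsum_cat; apply/esym/evens_bdsum_eq.
Qed.

Lemma AQ_bdsum_evens n l1 l2 : (1 < n)%N -> all (leq^~ n) (l1 ++ l2) ->
  ~~ odd (size (l1 ++ l2)) -> AQ (bdsum n l1) (bdsum n l2) ->
  exists i j, edge n i j /\ evens [:: i, j & l1 ++ l2].
Proof.
move=> n1 le od /(AQ_P _ _ n1)[i [j [ij]]]; rewrite -bdsum_cat => /esym E.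
exists i, j; split=> //; apply: (bdsum_eq_evens (l1 := [:: i; j])) E => /=.
  by rewrite le andbT; move: ij; rewrite /edge; lia.
by rewrite negbK.
Qed.

(** Finding common neighbors of two vertices becomes listing the ways to write their difference as a
    sum of two edges. *)
Lemma AQ_common n x l1 l2 : (1 < n)%N -> all (leq^~ n) (l1 ++ l2) ->
  ~~ odd (size (l1 ++ l2)) -> AQ x (bdsum n l1) -> AQ x (bdsum n l2) ->
  exists p q r s, [/\ edge n p q, edge n r s, x = bdsum n [:: p, q & l1] &
    evens [:: p, q, r, s & l1 ++ l2]].
Proof.
move=> n1 le od /(AQ_P _ _ n1)[p [q [pq E1]]] /(AQ_P _ _ n1)[r [s [rs E2]]].
have xE : x = bdsum n [:: p, q & l1].
  by rewrite -cat1s -(cat1s q) catA bdsum_cat -E1 -addrA row2_add_self addr0.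
exists p, q, r, s; split=> //; apply: (@bdsum_eq0_evens n).
- by move: pq rs; rewrite /= le andbT /edge; lia.
- by rewrite /= !negbK.
rewrite -[[:: _, _, _, _ & _]]/([:: p; q] ++ [:: r; s] ++ l1 ++ l2).
rewrite !bdsum_cat -E1 -E2 addrA [X in X + _]addrACA.
by rewrite row2_add_self add0r row2_add_self.
Qed.

(** * Pairs of edges with a given symmetric difference *)

Ltac edges_arith := unfold edge in *; lia.

Ltac edges_split :=
  repeat match goal with
  | K : is_true (edge _ _ _) |- _ => case/and3P: K => /leP ? /leP ? /leP ?
  | K : is_true (_ && _) |- _ => case/andP: K => ? ?
  | K : is_true (~~ (_ || _)) |- _ => case/norP: K => /eqP ? ?
  | K : is_true (~~ (_ == _)) |- _ => move/eqP: K => ?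
  end.

(** Runs through all pairings of the entries, pruning by arithmetic; five pairs are enough, as the
    lists met below have at most eight entries. *)
Ltac evens_cases H :=
  move/(evens_matched 5) in H; rewrite /= in H; edges_split;
  repeat match goal with
  | K : _ \/ _ |- _ => destruct K as [K|K]
  | K : _ /\ _ |- _ => destruct K as [? K]; try (exfalso; clear K; lia)
  | K : False |- _ => case: K
  end.

Ltac evens_tac := clear; move=> ? /=; lia.

Lemma edge_split2 n k m p q r s : (k.+3 <= m <= k + 4)%N ->
  edge n p q -> edge n r s -> evens [:: p; q; r; s; k; m] ->
  (p = k /\ k < q < m /\ m <= q.+2 \/ q = m /\ k < p < m /\ p <= k.+2)%N.
Proof. by move=> km pq rs e; evens_cases e; edges_arith. Qed.

Lemma edge_split_consec n i p q r s : edge n p q -> edge n r s ->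
  evens [:: p; q; r; s; i; i.+1; i.+2; i.+3] ->
  (p = i /\ i < q < i.+3 \/ q = i.+3 /\ i < p < i.+3)%N.
Proof. by move=> pq rs e; evens_cases e; clear e; edges_arith. Qed.

(** A second way to match the four vertices closes a 4-cycle. Its least vertex x has the neighbors
    x+1 and x+2 on it, and these are also the two neighbors of its greatest vertex, which is then
    x+3. *)
Lemma edge_split4 n a b c d p q r s :
  edge n a b -> edge n c d -> edge n p q -> edge n r s ->
  uniq [:: a; b; c; d] -> evens [:: p; q; r; s; a; b; c; d] ->
  [\/ p = a /\ q = b, p = c /\ q = d |
   exists2 i, (i + 3 <= n)%N & evens [:: a; b; c; d; i; i.+1; i.+2; i.+3]].
Proof.
move=> ab cd pq rs; rewrite /= !inE => u e.
have : [\/ p = a /\ q = b, p = c /\ q = d |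
  [\/ [/\ b = a.+1, c = a.+2 & d = a.+3], [/\ b = a.+2, c = a.+1 & d = a.+3],
      [/\ d = c.+1, a = c.+2 & b = c.+3] | [/\ d = c.+2, a = c.+1 & b = c.+3]]].
  evens_cases e; clear e; case: (eqVneq b a.+1); case: (eqVneq d c.+1) => ? ?;
    first [by apply: Or31; split; lia
    | by apply: Or32; split; lia
    | by apply: Or33; apply: Or41; split; lia
    | by apply: Or33; apply: Or42; split; lia
    | by apply: Or33; apply: Or43; split; lia
    | by apply: Or33; apply: Or44; split; lia].
case=> [?|?|H]; [exact: Or31|exact: Or32|apply: Or33].
by case: H => [] [e1 e2 e3]; [exists a | exists a | exists c | exists c];
  rewrite ?(e1, e2, e3); (try by edges_arith); evens_tac.
Qed.

(** Only k-1 and k+2 form a triangle with k and k+1. The case of k-1 is recorded just as an edge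
    within 0, ..., k+1, which the induction along the path already controls. *)
Lemma edge_split_short n k p q r s : edge n p q -> edge n r s ->
  evens [:: p; q; r; s; k; k.+1] ->
  (p < k /\ q <= k.+1 \/ q = k.+2 /\ k <= p <= k.+1)%N.
Proof. by move=> pq rs e; evens_cases e; clear e; lia. Qed.

Lemma edge_split_long n k p q r s : edge n p q -> edge n r s ->
  evens [:: p; q; r; s; k; k.+2] ->
  (p = k /\ q = k.+1 \/ p = k.+1 /\ q = k.+2)%N.
Proof. by move=> pq rs e; evens_cases e; clear e; lia. Qed.

(** * Basic symmetries of the graph *)

Lemma AQ_sym n (x y : 'rV['F_2]_n) : (1 < n)%N -> AQ x y = AQ y x.
Proof. by move=> n1; apply/AQ_P/AQ_P => //; rewrite addrC. Qed.

Lemma AQ_irr n (x : 'rV['F_2]_n) : (1 < n)%N -> AQ x x = false.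
Proof.
move=> n1; apply/negP => /(AQ_P _ _ n1)[i [j [ij]]]; rewrite row2_add_self.
move/esym/bdsum_eq0_evens => e; have {}e : evens [:: i; j].
  by apply: e => //=; edges_arith.
by evens_cases e; lia.
Qed.

Lemma AQ_add2l n (c x y : 'rV['F_2]_n) : (1 < n)%N ->
  AQ (c + x) (c + y) = AQ x y.
Proof.
have E : c + x + (c + y) = x + y by rewrite addrACA row2_add_self add0r.
by move=> n1; apply/AQ_P/AQ_P => //; rewrite E.
Qed.

Lemma delta_edge n (k : 'I_n) : (1 < n)%N -> exists i j,
  edge n i j /\ delta_mx ord0 k = bdsum n [:: i; j] :> 'rV['F_2]_n.
Proof.
move=> n1; suff /(AQ_P _ _ n1) : AQ 0 (delta_mx ord0 k : 'rV['F_2]_n).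
  by rewrite add0r.
apply/orP; left; apply/cards1P; exists k.
by apply/setP => i; rewrite !inE !mxE eqxx; case: (i == k).
Qed.

(** * Automorphisms fixing a vertex and its neighbors *)

Section Rigidity.

Variables (n : nat) (f : 'rV['F_2]_n -> 'rV['F_2]_n).
Hypotheses (hn : (4 <= n)%N) (finj : injective f)
  (fadj : forall x y, AQ (f x) (f y) = AQ x y).

Let n1 : (1 < n)%N. Proof. by lia. Qed.

(** Discards a candidate image that is already the image of another vertex. *)
Lemma image_inj_absurd l1 l2 l3 l4 :
  f (bdsum n l1) = bdsum n l3 -> f (bdsum n l2) = bdsum n l4 ->
  all (leq^~ n) (l1 ++ l2) -> ~~ odd (size (l1 ++ l2)) ->
  evens (l3 ++ l4) -> ~ evens (l1 ++ l2) -> False.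
Proof.
move=> f1 f2 le od e; apply; apply: (@bdsum_eq_evens n) => //; apply: finj.
by rewrite f1 f2; apply: evens_bdsum_eq.
Qed.

Lemma AQ_fixed x l : f (bdsum n l) = bdsum n l -> AQ x (bdsum n l) ->
  AQ (f x) (bdsum n l).
Proof. by move=> fl xl; rewrite -fl fadj. Qed.

Lemma fixed_common x l1 l2 : all (leq^~ n) (l1 ++ l2) ->
  ~~ odd (size (l1 ++ l2)) ->
  f (bdsum n l1) = bdsum n l1 -> f (bdsum n l2) = bdsum n l2 ->
  AQ x (bdsum n l1) -> AQ x (bdsum n l2) ->
  exists p q r s, [/\ edge n p q, edge n r s, f x = bdsum n [:: p, q & l1] &
    evens [:: p, q, r, s & l1 ++ l2]].
Proof.
by move=> ? ? f1 f2 /(AQ_fixed f1) ? /(AQ_fixed f2) ?; apply: AQ_common.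
Qed.

Section FixedBall.

Hypotheses (f0 : f (bdsum n [::]) = bdsum n [::])
  (fE : forall i j, edge n i j -> f (bdsum n [:: i; j]) = bdsum n [:: i; j]).

(** The only other common neighbor of {i, i+2} and {i+2, i+4} is 0. *)
Lemma fixed_dist4 i : (i + 4 <= n)%N ->
  f (bdsum n [:: i; i.+4]) = bdsum n [:: i; i.+4].
Proof.
move=> lin.
have e1 : edge n i i.+2 by edges_arith.
have e2 : edge n i.+2 i.+4 by edges_arith.
have [||||p [q [r [s [pq rs fx e]]]]] :=
  fixed_common (x := bdsum n [:: i; i.+4]) _ _ (fE e1) (fE e2).
- by rewrite /=; lia.
- by [].
- by apply: (AQ_bdsum n1 e2); evens_tac.
- by apply: (AQ_bdsum n1 e1); evens_tac.
have {}e : evens [:: p; q; r; s; i; i.+4].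
  by move=> m; move: (e m) => /=; clear; lia.
have km : (i.+3 <= i.+4 <= i + 4)%N by lia.
have := edge_split2 km pq rs e; case=> [[pE qE]|[qE pE]].
  have qE2 : q = i.+2 by edges_arith.
  exfalso; apply: (image_inj_absurd fx f0).
  - by rewrite /=; lia.
  - by [].
  - by rewrite pE qE2; evens_tac.
  by move=> K; evens_cases K; lia.
have pE2 : p = i.+2 by edges_arith.
by rewrite fx pE2 qE; apply: evens_bdsum_eq; evens_tac.
Qed.

Lemma fixed_dist3 i : (i + 3 <= n)%N ->
  f (bdsum n [:: i; i.+3]) = bdsum n [:: i; i.+3].
Proof.
move=> lin.
have e1 : edge n i i.+1 by edges_arith.
have e2 : edge n i.+1 i.+3 by edges_arith.
have e3 : edge n i.+1 i.+2 by edges_arith.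
have [||||p [q [r [s [pq rs fx e]]]]] :=
  fixed_common (x := bdsum n [:: i; i.+3]) _ _ (fE e1) (fE e2).
- by rewrite /=; lia.
- by [].
- by apply: (AQ_bdsum n1 e2); evens_tac.
- by apply: (AQ_bdsum n1 e1); evens_tac.
have {}e : evens [:: p; q; r; s; i; i.+3].
  by move=> m; move: (e m) => /=; clear; lia.
have km : (i.+3 <= i.+3 <= i + 4)%N by lia.
(* The test vertex {w, w+4} has w = i - 1 if i > 0, written without a predecessor, and w = 0 if i =
   0, where n >= 4 is needed. *)
have [w [iw nw]] : exists w, (w.+3 = i.+2 \/ w = i) /\ (w + 4 <= n)%N.
  by case: i lin {e1 e2 e3 fx e km} => [|i] lin; [exists 0%N | exists i]; lia.
have := edge_split2 km pq rs e; case=> [[pE qE]|[qE pE]].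
  have [qE1|qE2] : q = i.+1 \/ q = i.+2 by edges_arith.
    exfalso; apply: (image_inj_absurd fx f0).
    - by rewrite /=; lia.
    - by [].
    - by rewrite pE qE1; evens_tac.
    by move=> K; evens_cases K; lia.
  exfalso; apply: (image_inj_absurd fx (fE e3)).
  - by rewrite /=; lia.
  - by [].
  - by rewrite pE qE2; evens_tac.
  by move=> K; evens_cases K; lia.
have [pE1|pE2] : p = i.+1 \/ p = i.+2 by edges_arith.
  by rewrite fx pE1 qE; apply: evens_bdsum_eq; evens_tac.
(* The remaining candidate {i, i+1, i+2, i+3} is not adjacent to the fixed vertex {w, w+4}, whereas
   {i, i+3} is. *)
have : AQ (bdsum n [:: i; i.+1; i.+2; i.+3]) (bdsum n [:: w; w.+4]).
  rewrite -fixed_dist4 // (_ : bdsum n [:: i; _; _; _] = f (bdsum n [:: i; i.+3])).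
    rewrite fadj; case: iw => iw.
      have e4 : edge n w i by edges_arith.
      by apply: (AQ_bdsum n1 e4) => m /=; lia.
    have e4 : edge n i.+3 i.+4 by edges_arith.
    by apply: (AQ_bdsum n1 e4) => m /=; lia.
  by rewrite fx pE2 qE; apply: evens_bdsum_eq; evens_tac.
move/AQ_bdsum_evens; case=> //; first by rewrite /=; lia.
move=> j [k [jk K]].
by case: iw => iw; evens_cases K; lia.
Qed.

(** The other common neighbors of {i, i+1} and {i+2, i+3} are 0, {i+1, i+2} and {i, i+3}, all known
    to be fixed. *)
Lemma fixed_consec i : (i + 3 <= n)%N ->
  f (bdsum n [:: i; i.+1; i.+2; i.+3]) = bdsum n [:: i; i.+1; i.+2; i.+3].
Proof.
move=> lin.
have e1 : edge n i i.+1 by edges_arith.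
have e2 : edge n i.+2 i.+3 by edges_arith.
have e3 : edge n i.+1 i.+2 by edges_arith.
have [||||p [q [r [s [pq rs fx e]]]]] :=
  fixed_common (x := bdsum n [:: i; i.+1; i.+2; i.+3]) _ _ (fE e1) (fE e2).
- by rewrite /=; lia.
- by [].
- by apply: (AQ_bdsum n1 e2); evens_tac.
- by apply: (AQ_bdsum n1 e1); evens_tac.
have := edge_split_consec pq rs e; case=> [[pE qE]|[qE pE]].
  have [qE1|qE2] : q = i.+1 \/ q = i.+2 by edges_arith.
    exfalso; apply: (image_inj_absurd fx f0).
    - by rewrite /=; lia.
    - by [].
    - by rewrite pE qE1; evens_tac.
    by move=> K; evens_cases K; lia.
  exfalso; apply: (image_inj_absurd fx (fE e3)).
  - by rewrite /=; lia.
  - by [].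
  - by rewrite pE qE2; evens_tac.
  by move=> K; evens_cases K; lia.
have [pE1|pE2] : p = i.+1 \/ p = i.+2 by edges_arith.
  exfalso; apply: (image_inj_absurd fx (fixed_dist3 lin)).
  - by rewrite /=; lia.
  - by [].
  - by rewrite qE pE1; evens_tac.
  by move=> K; evens_cases K; lia.
by rewrite fx pE2 qE; apply: evens_bdsum_eq; evens_tac.
Qed.

Lemma fixed_le4 k m : (k < m <= k + 4)%N -> (m <= n)%N ->
  f (bdsum n [:: k; m]) = bdsum n [:: k; m].
Proof.
move=> km mn; have [|mE|mE] : [\/ (m <= k.+2)%N, m = k.+3 | m = k.+4].
- case: (leqP m k.+2) => ?; first exact: Or31.
  by case: (eqVneq m k.+3) => ?; [apply: Or32 | apply: Or33; lia].
- by move=> ?; apply: fE; edges_arith.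
- by rewrite mE in mn *; apply: fixed_dist3; lia.
- by rewrite mE in mn *; apply: fixed_dist4; lia.
Qed.

(** Edges sharing a vertex add up to 0 or to a pair at distance at most 4. Disjoint edges have only
    0 and their sum as common neighbors, unless their four ends are consecutive. *)
Lemma fixed_sum2 a b c d : edge n a b -> edge n c d ->
  f (bdsum n [:: a; b; c; d]) = bdsum n [:: a; b; c; d].
Proof.
move=> ab cd.
have two k m : (k <= n)%N -> (m <= n)%N -> (k <= m + 4)%N -> (m <= k + 4)%N ->
    evens [:: a; b; c; d; k; m] ->
    f (bdsum n [:: a; b; c; d]) = bdsum n [:: a; b; c; d].
  move=> kn mn km mk e.
  have -> : bdsum n [:: a; b; c; d] = bdsum n [:: k; m].
    by apply: evens_bdsum_eq.
  case: (ltngtP k m) => [km1|mk1|<-].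
  - by apply: fixed_le4; lia.
  - have -> : bdsum n [:: k; m] = bdsum n [:: m; k].
      by apply: evens_bdsum_eq; evens_tac.
    by apply: fixed_le4; lia.
  have -> : bdsum n [:: k; k] = bdsum n [::].
    by apply: evens_bdsum_eq; evens_tac.
  by [].
case: (eqVneq a c) => [ac|nac].
  by apply: (two b d); (try by edges_arith); rewrite ac; evens_tac.
case: (eqVneq a d) => [ac|nad].
  by apply: (two b c); (try by edges_arith); rewrite ac; evens_tac.
case: (eqVneq b c) => [ac|nbc].
  by apply: (two a d); (try by edges_arith); rewrite ac; evens_tac.
case: (eqVneq b d) => [ac|nbd].
  by apply: (two a c); (try by edges_arith); rewrite ac; evens_tac.
have u : uniq [:: a; b; c; d] by rewrite /= !inE; edges_arith.
have [||||p [q [r [s [pq rs fx e]]]]] :=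
  fixed_common (x := bdsum n [:: a; b; c; d]) _ _ (fE ab) (fE cd).
- by rewrite /=; edges_arith.
- by [].
- by apply: (AQ_bdsum n1 cd); evens_tac.
- by apply: (AQ_bdsum n1 ab); evens_tac.
case: (edge_split4 ab cd pq rs u e) => [[pE qE]|[pE qE]|[i lin ei]].
- exfalso; apply: (image_inj_absurd fx f0).
  + by rewrite /=; edges_arith.
  + by [].
  + by rewrite pE qE; evens_tac.
  by move=> K; evens_cases K; lia.
- by rewrite fx pE qE; apply: evens_bdsum_eq; evens_tac.
have -> : bdsum n [:: a; b; c; d] = bdsum n [:: i; i.+1; i.+2; i.+3].
  exact: evens_bdsum_eq.
exact: fixed_consec.
Qed.

End FixedBall.

(** * Automorphisms preserving the class of size three *)

(** No vertex is assumed fixed, so that this serves both when 0 and {0,1} are fixed and when they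
    are exchanged. *)
Lemma image_short k x : (k < n)%N -> AQ (f x) (bdsum n [::]) ->
  AQ (f x) (bdsum n [:: k; k.+1]) ->
  exists p q, [/\ edge n p q, f x = bdsum n [:: p; q] &
    (p < k /\ q <= k.+1 \/ q = k.+2 /\ k <= p <= k.+1)%N].
Proof.
move=> kn x0 x1; have [||p [q [r [s [pq rs fx e]]]]] := AQ_common n1 _ _ x0 x1.
- by rewrite /=; lia.
- by [].
by exists p, q; split=> //; apply: edge_split_short pq rs e.
Qed.

Section FixedTriple.

Hypotheses (f0 : f (bdsum n [::]) = bdsum n [::])
  (fa : f (bdsum n [:: 0; 1]%N) = bdsum n [:: 0; 1]%N)
  (fb : f (bdsum n [:: 0; 2; n.-1; n]%N) = bdsum n [:: 0; 2; n.-1; n]%N).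

Lemma fixed_edge_step k : (k.+2 <= n)%N ->
  (forall i j, edge n i j -> (j <= k.+1)%N ->
     f (bdsum n [:: i; j]) = bdsum n [:: i; j]) ->
  forall i j, edge n i j -> (j <= k.+2)%N ->
     f (bdsum n [:: i; j]) = bdsum n [:: i; j].
Proof.
move=> kn IH.
have ek : edge n k k.+1 by edges_arith.
have es : edge n k.+1 k.+2 by edges_arith.
have ee : edge n k k.+2 by edges_arith.
have fk := IH _ _ ek (leqnn _).
(* The edges {k, k+2} and {k+1, k+2} can only be permuted: the other common neighbors of 0 and {k,
   k+1} are fixed by induction. *)
have M i : (k <= i <= k.+1)%N ->
    exists2 j, (k <= j <= k.+1)%N &
      f (bdsum n [:: i; k.+2]) = bdsum n [:: j; k.+2].
  move=> ki; have ei : edge n i k.+2 by edges_arith.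
  have [|||p [q [pq fx]]] := @image_short k (bdsum n [:: i; k.+2]).
  - by lia.
  - by apply: (AQ_fixed f0); apply: (AQ_bdsum n1 ei); evens_tac.
  - apply: (AQ_fixed fk).
    have [iE|iE] : i = k \/ i = k.+1 by lia.
      by apply: (AQ_bdsum n1 es); rewrite iE; evens_tac.
    by apply: (AQ_bdsum n1 ee); rewrite iE; evens_tac.
  case=> [[pk qk]|[qE pE]]; last by exists p => //; rewrite fx qE.
  exfalso; apply: (image_inj_absurd fx (IH _ _ pq qk)).
  - by rewrite /=; edges_arith.
  - by [].
  - by evens_tac.
  by move=> K; evens_cases K; lia.
have fs : f (bdsum n [:: k.+1; k.+2]) = bdsum n [:: k.+1; k.+2].
  have [|j kj fj] := M k.+1; first by lia.
  have [jE|jE] : j = k \/ j = k.+1 by lia.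
    rewrite jE in fj; exfalso.
    (* If the two were exchanged and k+3 exists, the image of {k+2, k+3} would be a common neighbor
       of 0 and {k, k+2}. These are only {k, k+1} and {k+1, k+2}, both already images of other
       vertices. *)
    case: (ltnP k.+2 n) => kn3.
      have e3 : edge n k.+2 k.+3 by edges_arith.
      have e13 : edge n k.+1 k.+3 by edges_arith.
      have [|i ki fe] := M k; first by lia.
      have iE : i = k.+1.
        have [iE|//] : i = k \/ i = k.+1 by lia.
        exfalso; apply: (image_inj_absurd fj fe).
        - by rewrite /=; lia.
        - by [].
        - by rewrite iE; evens_tac.
        by move=> K; evens_cases K; lia.
      have A0 : AQ (f (bdsum n [:: k.+2; k.+3])) (bdsum n [::]).
        by apply: (AQ_fixed f0); apply: (AQ_bdsum n1 e3); evens_tac.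
      have A1 : AQ (f (bdsum n [:: k.+2; k.+3])) (bdsum n [:: k; k.+2]).
        by rewrite -fj fadj; apply: (AQ_bdsum n1 e13); evens_tac.
      have [||p [q [r [s [pq rs fx e]]]]] := AQ_common n1 _ _ A0 A1.
      - by rewrite /=; lia.
      - by [].
      have [[pE qE]|[pE qE]] := edge_split_long pq rs e.
        apply: (image_inj_absurd fx fk).
        - by rewrite /=; lia.
        - by [].
        - by rewrite pE qE; evens_tac.
        by move=> K; evens_cases K; lia.
      apply: (image_inj_absurd fx fe).
      - by rewrite /=; lia.
      - by [].
      - by rewrite pE qE iE; evens_tac.
      by move=> K; evens_cases K; lia.
    (* At the far end {n-1, n} is adjacent to {0, 2, n-1, n} through the edge {0, 2}, but {n-2, n}
       is not. *)
    have nE : n = k.+2 by lia.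
    have e02 : edge n 0 2 by edges_arith.
    have : AQ (f (bdsum n [:: k.+1; k.+2])) (bdsum n [:: 0; 2; n.-1; n]%N).
      apply: (AQ_fixed fb); apply: (AQ_bdsum n1 e02).
      by rewrite [in X in evens X]nE; evens_tac.
    rewrite fj => /AQ_bdsum_evens; case=> //; first by rewrite /=; lia.
    by move=> i [l [il K]]; evens_cases K; lia.
  by rewrite fj jE.
move=> i j ij; rewrite leq_eqVlt => /orP[/eqP jE|jk]; last exact: IH.
rewrite jE; have [->//|iE] : i = k.+1 \/ i = k by edges_arith.
rewrite iE; have [|l kl fl] := M k; first by lia.
have [lE|lE] : l = k \/ l = k.+1 by lia.
  by rewrite fl lE.
exfalso; apply: (image_inj_absurd fl fs).
- by rewrite /=; lia.
- by [].
- by rewrite lE; evens_tac.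
by move=> K; evens_cases K; lia.
Qed.

Lemma fixed_edges i j : edge n i j -> f (bdsum n [:: i; j]) = bdsum n [:: i; j].
Proof.
suff H k : (k < n)%N -> forall i j, edge n i j -> (j <= k.+1)%N ->
    f (bdsum n [:: i; j]) = bdsum n [:: i; j].
  by move=> ij; apply: (H n.-1) => //; edges_arith.
elim: k => [_ {}i {}j ij j1|k IH kn].
  have [-> ->] : i = 0%N /\ j = 1%N by edges_arith.
  exact: fa.
by apply: fixed_edge_step => //; apply: IH; lia.
Qed.

End FixedTriple.

(** The vertex {0, 2, n-1, n} is adjacent to {0,2} but not to {1,2}, so both of these are fixed.
    Then {1,2} would need as many common neighbors with {0,1} as with 0, which fails. *)
Lemma no_swap :
  f (bdsum n [::]) = bdsum n [:: 0; 1]%N ->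
  f (bdsum n [:: 0; 1]%N) = bdsum n [::] ->
  f (bdsum n [:: 0; 2; n.-1; n]%N) = bdsum n [:: 0; 2; n.-1; n]%N -> False.
Proof.
move=> f0 fa fb.
have e01 : edge n 0 1 by edges_arith.
have e02 : edge n 0 2 by edges_arith.
have e12 : edge n 1 2 by edges_arith.
have e13 : edge n 1 3 by edges_arith.
have e23 : edge n 2 3 by edges_arith.
have enn : edge n n.-1 n by edges_arith.
have M i : (i <= 1)%N -> exists2 j, (j <= 1)%N &
    f (bdsum n [:: i; 2]%N) = bdsum n [:: j; 2]%N.
  move=> i1; have [|||p [q [pq fx]]] := @image_short 0 (bdsum n [:: i; 2]%N).
  - by lia.
  - rewrite -fa fadj; have [->|->] : i = 0%N \/ i = 1%N by lia.
      by apply: (AQ_bdsum n1 e12); evens_tac.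
    by apply: (AQ_bdsum n1 e02); evens_tac.
  - rewrite -f0 fadj; have [->|->] : i = 0%N \/ i = 1%N by lia.
      by apply: (AQ_bdsum n1 e02); evens_tac.
    by apply: (AQ_bdsum n1 e12); evens_tac.
  by case=> [[//]|[qE pE]]; exists p; rewrite ?fx ?qE //; lia.
have f02 : f (bdsum n [:: 0; 2]%N) = bdsum n [:: 0; 2]%N.
  have [//|j j1 fj] := M 0%N.
  have [jE|jE] : j = 0%N \/ j = 1%N by lia.
    by rewrite fj jE.
  have : AQ (f (bdsum n [:: 0; 2]%N)) (bdsum n [:: 0; 2; n.-1; n]%N).
    by apply: (AQ_fixed fb); apply: (AQ_bdsum n1 enn); evens_tac.
  rewrite fj jE => /AQ_bdsum_evens; case=> //; first by rewrite /=; lia.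
  by move=> i [l [il K]]; evens_cases K; lia.
have f12 : f (bdsum n [:: 1; 2]%N) = bdsum n [:: 1; 2]%N.
  have [//|j j1 fj] := M 1%N.
  have [jE|jE] : j = 0%N \/ j = 1%N by lia.
    exfalso; apply: (image_inj_absurd fj f02).
    - by rewrite /=; lia.
    - by [].
    - by rewrite jE; evens_tac.
    by move=> K; evens_cases K; lia.
  by rewrite fj jE.
(* The common neighbors of {0,1} and {1,2} are only 0 and {0,2}, the images of {0,1} and {0,2}, so
   none is left for {2,3}. *)
have A0 : AQ (f (bdsum n [:: 2; 3]%N)) (bdsum n [:: 0; 1]%N).
  by rewrite -f0 fadj; apply: (AQ_bdsum n1 e23); evens_tac.
have A1 : AQ (f (bdsum n [:: 2; 3]%N)) (bdsum n [:: 1; 2]%N).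
  by apply: (AQ_fixed f12); apply: (AQ_bdsum n1 e13); evens_tac.
have [||p [q [r [s [pq rs fx e]]]]] := AQ_common n1 _ _ A0 A1.
- by rewrite /=; lia.
- by [].
have {}e : evens [:: p; q; r; s; 0; 2]%N.
  by move=> m; move: (e m) => /=; clear; lia.
have [[pE qE]|[pE qE]] := edge_split_long pq rs e.
  apply: (image_inj_absurd fx fa).
  - by rewrite /=; lia.
  - by [].
  - by rewrite pE qE; evens_tac.
  by move=> K; evens_cases K; lia.
apply: (image_inj_absurd fx f02).
- by rewrite /=; lia.
- by [].
- by rewrite pE qE; evens_tac.
by move=> K; evens_cases K; lia.
Qed.

End Rigidity.

(** * From the neighborhood of 0 to the whole graph *)

Lemma fixed_ball_id n (f : 'rV['F_2]_n -> 'rV['F_2]_n) : (4 <= n)%N ->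
  injective f -> (forall x y, AQ (f x) (f y) = AQ x y) ->
  f (bdsum n [::]) = bdsum n [::] ->
  (forall i j, edge n i j -> f (bdsum n [:: i; j]) = bdsum n [:: i; j]) ->
  f =1 id.
Proof.
move=> hn finj fadj f0 fE; have n1 : (1 < n)%N by lia.
pose Q c := f c = c /\
  forall i j, edge n i j -> f (c + bdsum n [:: i; j]) = c + bdsum n [:: i; j].
have Q0 : Q 0.
  have <- : bdsum n [::] = 0 by rewrite /bdsum big_nil.
  by split=> // i j ij; rewrite -bdsum_cat fE.
have QS c i j : edge n i j -> Q c -> Q (c + bdsum n [:: i; j]).
  move=> ij [fc fcE]; split=> [|k m km]; first exact: fcE.
  pose g x := c + f (c + x).
  have gK x : f (c + x) = c + g x by rewrite row2_addK.
  have gb : g (bdsum n [:: i; j; k; m]) = bdsum n [:: i; j; k; m].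
    apply: fixed_sum2 => //.
    - by move=> x y /addrI/finj/addrI.
    - by move=> x y; rewrite AQ_add2l // fadj AQ_add2l.
    - by rewrite /g /bdsum big_nil addr0 fc row2_add_self.
    - by move=> p q pq; rewrite /g fcE // row2_addK.
  by rewrite -addrA -bdsum_cat gK gb.
move=> x; suff [] : Q x by [].
(* Unit vectors are generators, so adding them one at a time gives a walk from 0 to x along which
   [Q] propagates. *)
rewrite [x]row_sum_delta; elim/big_rec: _ => // k c _ Qc.
have [->|->] : x ord0 k = 0 \/ x ord0 k = 1.
- by case: (x ord0 k) => [[|[|//]] p]; [left|right]; apply/val_inj.
- by rewrite scale0r add0r.
have [i [j [ij ->]]] := delta_edge k n1.
by rewrite scale1r addrC; apply: QS.
Qed.

(** * A distinguishing class of size three *)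

Lemma bdsum_neq n l1 l2 : all (leq^~ n) (l1 ++ l2) ->
  ~~ odd (size (l1 ++ l2)) -> ~ evens (l1 ++ l2) -> bdsum n l1 != bdsum n l2.
Proof. by move=> le od e; apply/eqP => /(bdsum_eq_evens le od). Qed.

(** The third vertex is the sum of the edges {0,2} and {n-1, n}, so it is adjacent to both and can
    detect swaps at either end of the path. *)
Definition triple n : {set 'rV['F_2]_n} :=
  [set bdsum n [::]; bdsum n [:: 0; 1]%N; bdsum n [:: 0; 2; n.-1; n]%N].

(** As 0 and {0,1} form the only edge within the class, a class-preserving automorphism fixes or
    exchanges them and fixes the third vertex. *)
Lemma triple_adj n (x y : 'rV['F_2]_n) : (4 <= n)%N ->
  x \in triple n -> y \in triple n -> AQ x y ->
  x = bdsum n [::] /\ y = bdsum n [:: 0; 1]%N \/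
  x = bdsum n [:: 0; 1]%N /\ y = bdsum n [::].
Proof.
move=> hn; have n1 : (1 < n)%N by lia.
have A0b : AQ (bdsum n [::]) (bdsum n [:: 0; 2; n.-1; n]%N) = false.
  apply/negP => /AQ_bdsum_evens; case=> //; first by rewrite /=; lia.
  by move=> i [l [il K]]; evens_cases K; lia.
have Aab : AQ (bdsum n [:: 0; 1]%N) (bdsum n [:: 0; 2; n.-1; n]%N) = false.
  apply/negP => /AQ_bdsum_evens; case=> //; first by rewrite /=; lia.
  by move=> i [l [il K]]; evens_cases K; lia.
rewrite !inE -!orbA.
by case/or3P=> /eqP-> /or3P[] /eqP->; rewrite ?AQ_irr ?A0b ?Aab //;
  auto; rewrite AQ_sym ?A0b ?Aab.
Qed.

Lemma triple_neq n : (4 <= n)%N ->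
  [/\ bdsum n [::] != bdsum n [:: 0; 1]%N,
      bdsum n [::] != bdsum n [:: 0; 2; n.-1; n]%N &
      bdsum n [:: 0; 1]%N != bdsum n [:: 0; 2; n.-1; n]%N].
Proof.
by move=> hn; split; apply: bdsum_neq => //=; try lia;
  move=> K; evens_cases K; lia.
Qed.

Lemma card_triple n : (4 <= n)%N -> #|triple n| = 3%N.
Proof.
move=> hn; have [oa ob ab] := triple_neq hn.
by rewrite /triple setUC cardsU1 cards2 !inE eq_sym (negbTE ob) eq_sym
  (negbTE ab) oa.
Qed.

Lemma triple_fixed_id n (f : {perm 'rV['F_2]_n}) : (4 <= n)%N ->
  is_automorphism (@AQ n) f -> f @: triple n = triple n -> f = 1%g.
Proof.
move=> hn /forallP af fT; have n1 : (1 < n)%N by lia.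
have fadj x y : AQ (f x) (f y) = AQ x y by apply/eqP/(forallP (af x)).
have finj : injective f by exact: perm_inj.
have inT x : x \in triple n -> f x \in triple n.
  by move=> xT; rewrite -fT imset_f.
have := triple_neq hn.
set o := bdsum n [::]; set a := bdsum n [:: 0; 1]%N.
set b := bdsum n [:: 0; 2; n.-1; n]%N => -[oa ob ab].
have oT : o \in triple n by rewrite !inE eqxx.
have aT : a \in triple n by rewrite !inE eqxx orbT.
have bT : b \in triple n by rewrite !inE eqxx orbT.
have Aoa : AQ (f o) (f a).
  have e01 : edge n 0 1 by edges_arith.
  by rewrite fadj; apply: (AQ_bdsum n1 e01); evens_tac.
have fbT := inT _ bT; rewrite !inE -/o -/a -/b -orbA in fbT.
have [[fo fa]|[fo fa]] := triple_adj hn (inT _ oT) (inT _ aT) Aoa.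
  have fb : f b = b.
    case/or3P: fbT => /eqP // E.
      by move: ob; rewrite (finj _ _ (etrans E (esym fo))) eqxx.
    by move: ab; rewrite (finj _ _ (etrans E (esym fa))) eqxx.
  apply/permP => x; rewrite perm1; apply: (fixed_ball_id hn finj fadj fo) => i j.
  exact: (fixed_edges hn finj fadj fo fa fb).
have fb : f b = b.
  case/or3P: fbT => /eqP // E.
    by move: ab; rewrite (finj _ _ (etrans E (esym fa))) eqxx.
  by move: ob; rewrite (finj _ _ (etrans E (esym fo))) eqxx.
by case: (no_swap hn finj fadj fo fa fb).
Qed.

(** * Classes of size at most two *)

(** An injection of a finite class into itself is onto, and with two colors the other class is the
    complement. *)
Lemma distinguishing_stab (V : finType) (e : rel V) (c : {ffun V -> 'I_2})
    (i : 'I_2) (f : {perm V}) :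
  distinguishing e c -> is_automorphism e f ->
  (forall x, x \in color_class c i -> f x \in color_class c i) -> f = 1%g.
Proof.
move=> /forallP/(_ f)/implyP dc af fA; apply/eqP/dc; rewrite af /=.
have fAE : f @: color_class c i = color_class c i.
  apply/eqP; rewrite eqEcard card_imset ?leqnn ?andbT; last exact: perm_inj.
  by apply/subsetP => _ /imsetP[x xA ->]; apply: fA.
have cf x : (c (f x) == i) = (c x == i).
  have := mem_imset (color_class c i) x (@perm_inj _ f).
  by rewrite fAE !inE.
have I2 (u v w : 'I_2) : (u == w) = (v == w) -> u = v.
  case: u v w => [[|[|//]] ?] [[|[|//]] ?] [[|[|//]] ?] //= _; exact/val_inj.
apply/forallP => j; rewrite eqEcard card_imset ?leqnn ?andbT; last first.
  exact: perm_inj.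
apply/subsetP => _ /imsetP[x xA ->]; rewrite !inE in xA *.
by rewrite (I2 _ _ _ (cf x)).
Qed.

Definition translation n (d : 'rV['F_2]_n) : {perm 'rV['F_2]_n} :=
  perm (@addrI _ d).

Lemma translation_aut n (d : 'rV['F_2]_n) : (1 < n)%N ->
  is_automorphism (@AQ n) (translation d).
Proof.
move=> n1; apply/forallP => x; apply/forallP => y.
by rewrite !permE AQ_add2l.
Qed.

Lemma translation_neq1 n (d : 'rV['F_2]_n) : d != 0 -> translation d <> 1%g.
Proof.
move=> d0 /permP/(_ 0); rewrite permE perm1 addr0 => dE.
by rewrite dE eqxx in d0.
Qed.

(* This linear map exchanges the edges {0,1} and {0,2} of the squared path and
   fixes all the others. *)
Definition endswap n (k0 : 'I_n) (x : 'rV['F_2]_n) :=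
  x + x ord0 k0 *: bdsum n [:: 1; 2]%N.

Section EndSwap.

Variables (n : nat) (k0 : 'I_n).
Hypotheses (n1 : (1 < n)%N) (k00 : k0 = 0%N :> nat).

Lemma endswapD x y : endswap k0 (x + y) = endswap k0 x + endswap k0 y.
Proof. by rewrite /endswap mxE scalerDl addrACA. Qed.

Lemma endswapK : involutive (endswap k0).
Proof.
move=> x; rewrite /endswap !mxE bdsum_suffix k00 mulr0 addr0 -addrA.
by rewrite row2_add_self addr0.
Qed.

Lemma endswap_edge i j : edge n i j ->
  exists p q, edge n p q /\ endswap k0 (bdsum n [:: i; j]) = bdsum n [:: p; q].
Proof.
move=> ij; rewrite /endswap bdsum2 !mxE -bdsum2 k00 -natrD.
(* The coordinate at index 0 is 1 exactly for the edges at path vertex 0; for these, j is 1 or 2 and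
   [3 - j] is the other value. *)
have [i0|i0] := posnP i; last first.
  exists i, j; split=> //.
  by rewrite (_ : (_ + _)%N = 2) ?(natF2_eq (p := 0)) ?scale0r ?addr0 //; edges_arith.
exists 0%N, (3 - j)%N; split; first by edges_arith.
rewrite (_ : (_ + _)%N = 1%N) ?scale1r; last by edges_arith.
rewrite -bdsum_cat i0; apply: evens_bdsum_eq.
have [->|->] : j = 1%N \/ j = 2%N by edges_arith.
  by evens_tac.
by evens_tac.
Qed.

Lemma endswap_adj x y : AQ (endswap k0 x) (endswap k0 y) = AQ x y.
Proof.
have H u v : AQ u v -> AQ (endswap k0 u) (endswap k0 v).
  move=> /(AQ_P _ _ n1)[i [j [ij E]]]; apply/AQ_P => //.
  by rewrite -endswapD E; apply: endswap_edge.
by apply/idP/idP => [/H|/H//]; rewrite !endswapK.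
Qed.

End EndSwap.

Definition triple_coloring n : {ffun 'rV['F_2]_n -> 'I_2} :=
  [ffun x => if x \in triple n then ord0 else ord_max].

Lemma triple_coloring_class n : color_class (triple_coloring n) ord0 = triple n.
Proof. by apply/setP => x; rewrite inE ffunE; case: (x \in triple n). Qed.

Lemma triple_coloring_distinguishing n : (4 <= n)%N ->
  distinguishing (@AQ n) (triple_coloring n).
Proof.
move=> hn; apply/forallP => f; apply/implyP => /andP[af /forallP/(_ ord0)/eqP].
by rewrite triple_coloring_class => fT; apply/eqP; apply: triple_fixed_id.
Qed.

Lemma distinguishing_card_AQ n (c : {ffun 'rV['F_2]_n -> 'I_2}) i :
  (1 < n)%N -> distinguishing (@AQ n) c -> (3 <= #|color_class c i|)%N.
Proof.
move=> n1 dc; have n0 : (0 < n)%N by lia.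
pose k0 := Ordinal n0.
have st := distinguishing_stab (i := i) dc.
have ne : bdsum n [:: 0; 2]%N != bdsum n [:: 0; 1]%N.
  by apply: bdsum_neq => //=; [lia | move=> K; evens_cases K; lia].
case: (ltngtP #|color_class c i| 1) => [|c2|/eqP/cards1P[a aE]].
- rewrite ltnS leqn0 cards_eq0 => /eqP c0; exfalso.
  (* Any nonzero translation would do; this one is nonzero by [ne]. *)
  apply: (translation_neq1 (d := bdsum n [:: 0; 2]%N + bdsum n [:: 0; 1]%N)).
    by rewrite row2_add_eq0.
  by apply: st (translation_aut _ n1) _ => x; rewrite c0 inE.
- rewrite ltn_neqAle c2 andbT; apply/negP => /eqP/esym/eqP/cards2P[a [b [ab aE]]].
  apply: (translation_neq1 (d := a + b)); first by rewrite row2_add_eq0.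
  apply: st (translation_aut _ n1) _ => x; rewrite aE !inE permE.
  case/orP=> /eqP ->; first by rewrite addrC row2_addK eqxx orbT.
  by rewrite addrC [a + b]addrC row2_addK eqxx.
have swK := endswapK (k0 := k0) erefl.
have ginj : injective (fun x => a + endswap k0 (a + x)).
  by move=> x y /addrI/(inv_inj swK)/addrI.
have : perm ginj = 1%g.
  apply: st => [|x].
    apply/forallP => x; apply/forallP => y.
    by rewrite !permE AQ_add2l // endswap_adj // AQ_add2l.
  rewrite aE !inE permE => /eqP->.
  by rewrite row2_add_self /endswap mxE scale0r !addr0.
(* The map sends a + {0,1} to a + {0,2}, hence is not the identity. *)
move/permP/(_ (a + bdsum n [:: 0; 1]%N)); rewrite permE perm1 row2_addK.
move/addrI => E; exfalso; move/eqP: ne; apply; rewrite -E.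
rewrite /endswap bdsumE /= scale1r -bdsum_cat.
by apply: evens_bdsum_eq; evens_tac.
Qed.

Local Close Scope ring_scope.

Theorem theorem7p6 (n : nat) (hn : 4 <= n) : cost (@AQ n) = 3.
Proof.
apply/eqP; rewrite eqn_leq.
have dc0 := triple_coloring_distinguishing hn.
have := cost_le ord0 dc0; rewrite triple_coloring_class card_triple // => -> /=.
have [|c [i [dc <-]]] := @cost_attained _ (@AQ n).
  by exists (triple_coloring n).
by apply: distinguishing_card_AQ => //; lia.
Qed.
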